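(* Let $C\subseteq\mathbb{R}^n$ be a nonempty closed convex set and let $f:\mathbb{R}^n\times\mathbb{R}^n\to\mathbb{R}$ satisfy $f(x,x)=0$ for all $x\in C$. Assume that $f$ is jointly continuous on an open set containing $C\times C$, that $f(x,\cdot)$ is semi-strictly quasiconvex on $C$ for every $x\in C$, and that the set $S_d=\{z\in C: f(y,z)\le 0\ \ \forall y\in C\}$ is nonempty. Let $\{x^k\}_{k\ge 0}$ be an infinite sequence generated by the extragradient linesearch algorithm described in the context (so the algorithm does not terminate), with regularization parameters $\rho_k$ nonincreasing and converging to $\overline{\rho}>0$, and assume that the associated sequence $\{y^k\}$ is bounded. Then there exists a subsequence of $\{x^k\}$ converging to a $\overline{\rho}$-quasi-solution $\overline{x}$, i.e. to a point $\overline{x}\in C$ with $$f(\overline{x},y)+\frac{1}{2\overline{\rho}}\|y-\overline{x}\|^2\ge 0\qquad\forall y\in C.$$ If, in addition, $f(x,\cdot)$ is strongly quasiconvex on $C$ for every $x\in C$, then the whole sequence $\{x^k\}$ converges to the unique solution of the equilibrium problem: find $x^*\in C$ such that $f(x^*,y)\ge 0$ for all $y\in C$.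
   Context: $\|\cdot\|$ and $\langle\cdot,\cdot\rangle$ are the Euclidean norm and inner product on $\mathbb{R}^n$, and $P_C$ is the metric projection onto $C$. A function $\varphi$ is quasiconvex on $C$ if $\varphi((1-\lambda)x+\lambda y)\le\max\{\varphi(x),\varphi(y)\}$ for all $x,y\in C$, $\lambda\in[0,1]$. It is semi-strictly quasiconvex on $C$ if it is quasiconvex on $C$ and, for all $x,y\in C$ and $\lambda\in(0,1)$, $\varphi(x)<\varphi(y)$ implies $\varphi((1-\lambda)x+\lambda y)<\varphi(y)$. It is strongly quasiconvex on $C$ with modulus $\gamma\in(0,\infty)$ if $\varphi(\lambda x+(1-\lambda)y)\le\max\{\varphi(x),\varphi(y)\}-\lambda(1-\lambda)\frac{\gamma}{2}\|x-y\|^2$ for all $x,y\in C$, $\lambda\in[0,1]$; it is strongly quasiconvex if this holds for some such modulus. Star-subdifferential in the second variable: $$\partial_2^*f(z,x)=\{g\in\mathbb{R}^n:\ \langle g,y-x\rangle<0\ \text{ for every } y\in\mathbb{R}^n \text{ with } f(z,y)<f(z,x)\}.$$ Algorithm. Fix $\alpha,\theta\in(0,1)$ and sequences of positive numbers $\{\rho_k\}_{k\ge0}$, $\{\sigma_k\}_{k\ge0}$ such that $\rho_k$ is nonincreasing and converges to some $\overline{\rho}>0$, $\sum_{k}\sigma_k=\infty$ and $\sum_k\sigma_k^2<\infty$. Pick $x^0\in C$. At iteration $k=0,1,\dots$: (1) Choose $y^k\in\operatorname{argmin}_{y\in C}\{f(x^k,y)+\frac{1}{2\rho_k}\|x^k-y\|^2\}$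 (assumed to exist). If $y^k=x^k$, stop. (2) If $y^k\ne x^k$, let $m$ be the smallest positive integer such that, with $z^{k,m}=(1-\theta^m)x^k+\theta^m y^k$, $$f(z^{k,m},x^k)-f(z^{k,m},y^k)\ge\frac{\alpha}{2\rho_k}\|y^k-x^k\|^2,$$ and set $z^k=z^{k,m}$. (3) Take $g^k\in\partial_2^*f(z^k,x^k)$ normalized so that $\|g^k\|=1$, and set $x^{k+1}=P_C(x^k-\sigma_kg^k)$. If $x^{k+1}=x^k$, stop; otherwise continue with $k+1$. The algorithm does not terminate if no stopping test is ever satisfied, so that it produces infinite sequences $\{x^k\},\{y^k\},\{z^k\},\{g^k\}$. *)

(* Defs.v *)
From mathcomp Require Import all_boot all_order all_algebra.
From mathcomp Require Import all_classical all_reals all_analysis.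

Set Implicit Arguments.
Unset Strict Implicit.
Unset Printing Implicit Defensive.

Import Order.TTheory GRing.Theory Num.Theory.
Import numFieldNormedType.Exports.

Local Open Scope classical_set_scope.
Local Open Scope ring_scope.

(* The library's norm `|u| on 'rV[R]_n is the max norm. All metric quantities
   below use enorm instead; the library norm only enters through notions that
   are the same for both norms (open, closed, continuous, limit, bounded). *)
Definition dotp (R : realType) (n : nat) (u v : 'rV[R]_n) : R :=
  \sum_(i < n) u 0 i * v 0 i.

Definition enorm (R : realType) (n : nat) (u : 'rV[R]_n) : R :=
  Num.sqrt (dotp u u).

Definition argmin_on (R : realType) (n : nat) (C : set 'rV[R]_n)
    (phi : 'rV[R]_n -> R) : set 'rV[R]_n :=
  [set y | C y /\ forall w, C w -> phi y <= phi w].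

(* p = P_C(u), as a relation; when C is nonempty, closed and convex there is
   exactly one such p. *)
Definition is_metric_proj (R : realType) (n : nat) (C : set 'rV[R]_n)
    (u p : 'rV[R]_n) : Prop :=
  argmin_on C (fun w => enorm (u - w)) p.

Definition quasiconvex_on (R : realType) (n : nat) (C : set 'rV[R]_n)
    (phi : 'rV[R]_n -> R) : Prop :=
  forall (x y : 'rV[R]_n) (l : R), C x -> C y -> 0 <= l <= 1 ->
    phi ((1 - l) *: x + l *: y) <= Num.max (phi x) (phi y).

Definition semistrictly_quasiconvex_on (R : realType) (n : nat)
    (C : set 'rV[R]_n) (phi : 'rV[R]_n -> R) : Prop :=
  quasiconvex_on C phi /\
  forall (x y : 'rV[R]_n) (l : R), C x -> C y -> 0 < l < 1 ->
    phi x < phi y -> phi ((1 - l) *: x + l *: y) < phi y.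

Definition strongly_quasiconvex_on (R : realType) (n : nat)
    (C : set 'rV[R]_n) (phi : 'rV[R]_n -> R) : Prop :=
  exists2 gamma : R, 0 < gamma &
    forall (x y : 'rV[R]_n) (l : R), C x -> C y -> 0 <= l <= 1 ->
      phi (l *: x + (1 - l) *: y) <=
      Num.max (phi x) (phi y)
        - l * (1 - l) * (gamma / 2) * enorm (x - y) ^+ 2.

(* y ranges over the whole space, not only over C. *)
Definition star_subdiff2 (R : realType) (n : nat)
    (f : 'rV[R]_n -> 'rV[R]_n -> R) (z x : 'rV[R]_n) : set 'rV[R]_n :=
  [set g | forall y, f z y < f z x -> dotp g (y - x) < 0].

Definition dual_solutions (R : realType) (n : nat) (C : set 'rV[R]_n)
    (f : 'rV[R]_n -> 'rV[R]_n -> R) : set 'rV[R]_n :=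
  [set z | C z /\ forall y, C y -> f y z <= 0].

Definition equilibria (R : realType) (n : nat) (C : set 'rV[R]_n)
    (f : 'rV[R]_n -> 'rV[R]_n -> R) : set 'rV[R]_n :=
  [set x | C x /\ forall y, C y -> 0 <= f x y].

Definition quasi_solutions (R : realType) (n : nat) (C : set 'rV[R]_n)
    (f : 'rV[R]_n -> 'rV[R]_n -> R) (rho : R) : set 'rV[R]_n :=
  [set x | C x /\
    forall y, C y -> 0 <= f x y + (2 * rho)^-1 * enorm (y - x) ^+ 2].

Definition trial_point (R : realType) (n : nat) (theta : R)
    (x y : 'rV[R]_n) (m : nat) : 'rV[R]_n :=
  (1 - theta ^+ m) *: x + theta ^+ m *: y.

Definition linesearch_test (R : realType) (n : nat)
    (f : 'rV[R]_n -> 'rV[R]_n -> R) (alpha theta rho : R)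
    (x y : 'rV[R]_n) (m : nat) : Prop :=
  let zm := trial_point theta x y m in
  f zm x - f zm y >= alpha / (2 * rho) * enorm (y - x) ^+ 2.

Definition is_least_positive (P : nat -> Prop) (m : nat) : Prop :=
  [/\ (0 < m)%N, P m & forall j : nat, (0 < j)%N -> P j -> (m <= j)%N].

Record algorithm_parameters (R : realType) (alpha theta : R)
    (rho sigma : nat -> R) (rhobar : R) : Prop := AlgorithmParameters {
  alpha_in01 : 0 < alpha < 1;
  theta_in01 : 0 < theta < 1;
  rho_pos : forall k, 0 < rho k;
  sigma_pos : forall k, 0 < sigma k;
  rho_nonincreasing : nonincreasing_seq rho;
  rho_cvg : rho @ \oo --> rhobar;
  rhobar_pos : 0 < rhobar;
  sigma_diverges : series sigma @ \oo --> +oo;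
  sigma2_summable : cvgn (series (fun k => sigma k ^+ 2))
}.

(* An infinite run: no_stop_y and no_stop_x say that neither stopping test is
   ever met, so every step is carried out for every k. *)
Record infinite_run (R : realType) (n : nat) (C : set 'rV[R]_n)
    (f : 'rV[R]_n -> 'rV[R]_n -> R) (alpha theta : R) (rho sigma : nat -> R)
    (x y z g : nat -> 'rV[R]_n) : Prop := InfiniteRun {
  start_in : C (x 0%N);
  prox_step : forall k,
    argmin_on C
      (fun w => f (x k) w + (2 * rho k)^-1 * enorm (x k - w) ^+ 2) (y k);
  no_stop_y : forall k, y k <> x k;
  linesearch_step : forall k, exists2 m : nat,
    is_least_positive
      (linesearch_test f alpha theta (rho k) (x k) (y k)) m &
    z k = trial_point theta (x k) (y k) m;
  subgradient_step : forall k, star_subdiff2 f (z k) (x k) (g k);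
  subgradient_normalized : forall k, enorm (g k) = 1;
  projection_step : forall k, is_metric_proj C (x k - sigma k *: g k) (x k.+1);
  no_stop_x : forall k, x k.+1 <> x k
}.

(* Main.v *)
Require Import Defs.
From mathcomp Require Import all_boot all_order all_algebra.
From mathcomp Require Import all_classical all_reals all_analysis.
From mathcomp Require Import ring lra.

Set Implicit Arguments.
Unset Strict Implicit.
Unset Printing Implicit Defensive.

Import Order.TTheory GRing.Theory Num.Theory.
Import numFieldNormedType.Exports.

Local Open Scope classical_set_scope.
Local Open Scope ring_scope.

(** Fix a dual solution [p]. The linesearch places [z k] strictly between [x k]
    and [y k] with [f (z k) (y k) < f (z k) (x k)], so semi-strict
    quasiconvexity forces [f (z k) (x k) > f (z k) (z k) = 0], whereas
    [f (z k) p <= 0] ([f_zx_gt0]). Hence the hyperplane through [x k] with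
    normal [g k] strictly separates [x k] from [p], and the projected step gives
    [|x k.+1 - p|^2 <= |x k - p|^2 - 2 sigma k <g k, x k - p> + sigma k ^+ 2]
    ([quasi_fejer_step]). Since the squares of the steps are summable, the
    distances to [p] converge; since the steps are not, the gains
    [<g k, x k - p>] come arbitrarily close to [0].

    In place of nested subsequences, an ultrafilter on the indices is chosen
    along which the index goes to infinity and the gains tend to [0]; the
    bounded sequences [x], [y], [z], [g] then all converge along it, to [xb],
    [yb], [zb], [gb]. Because [<gb, xb - p> = 0], closedness of the star
    subdifferential yields [f zb xb <= f zb p <= 0] ([star_subdiff2_limit_le]).
    This forces [yb = xb] ([limit_y_eq_x]): when the accepted steps
    [theta ^+ m] do not vanish, the linesearch test survives in the limit and
    would make [f zb xb] positive by semi-strictness; when they vanish, the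
    trial points just before the accepted ones fail the test and converge to
    [xb], which contradicts optimality of [yb] in the limiting proximal problem
    as [alpha < 1]. With [yb = xb], that limiting problem says that [xb] is a
    quasi-solution, and a subsequence of [x] converges to it.

    When the functions [f u] are strongly quasiconvex, a quasi-solution [u]
    satisfies [f u w > 0] for all [w != u] in [C]: on the segment from [u] to a
    counterexample, the strong-quasiconvexity term is of first order and beats
    the second-order regularization. As [f u p <= 0], every quasi-solution and
    every equilibrium is [p] itself; the convergent distances to [p] then tend
    to [0] along a subsequence, hence along the whole sequence. *)

(** * Euclidean geometry and metric projections *)

Section Euclidean.
Context {R : realType} {n : nat}.
Implicit Types (u v w p : 'rV[R]_n) (C : set 'rV[R]_n) (a l : R).

Lemma dotpC u v : dotp u v = dotp v u.
Proof. by apply: eq_bigr => i _; rewrite mulrC. Qed.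

Lemma dotpDl u v w : dotp (u + v) w = dotp u w + dotp v w.
Proof.
by rewrite /dotp -big_split; apply: eq_bigr => i _; rewrite mxE mulrDl.
Qed.

Lemma dotpDr u v w : dotp u (v + w) = dotp u v + dotp u w.
Proof. by rewrite ![dotp u _]dotpC dotpDl. Qed.

Lemma dotpZl a u v : dotp (a *: u) v = a * dotp u v.
Proof.
by rewrite /dotp mulr_sumr; apply: eq_bigr => i _; rewrite mxE mulrA.
Qed.

Lemma dotpZr a u v : dotp u (a *: v) = a * dotp u v.
Proof. by rewrite ![dotp u _]dotpC dotpZl. Qed.

Lemma dotpNl u v : dotp (- u) v = - dotp u v.
Proof. by rewrite -scaleN1r dotpZl mulN1r. Qed.

Lemma dotpNr u v : dotp u (- v) = - dotp u v.
Proof. by rewrite ![dotp u _]dotpC dotpNl. Qed.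

Lemma dotpp_ge0 u : 0 <= dotp u u.
Proof. by apply: sumr_ge0 => i _; rewrite -expr2 sqr_ge0. Qed.

Lemma enorm_sqr u : enorm u ^+ 2 = dotp u u.
Proof. by rewrite sqr_sqrtr// dotpp_ge0. Qed.

(** The max norm is dominated by the Euclidean one; this transfers boundedness
    and convergence from [dotp] to the topology of row vectors. *)
Lemma normr_sqr_le_dotp u : `|u| ^+ 2 <= dotp u u.
Proof.
have [u0|] := eqVneq `|u| 0; first by rewrite u0 expr0n/= dotpp_ge0.
move=> /mx_norm_neq0[[i j] /= uij]; rewrite (uij : `|u| = _).
rewrite real_normK ?num_real// (ord1 i) /dotp (bigD1 j)//= -expr2 lerDl.
by apply: sumr_ge0 => k _; rewrite -expr2 sqr_ge0.
Qed.

Lemma dotp00 : dotp (0 : 'rV[R]_n) 0 = 0.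
Proof. by rewrite /dotp big1// => i _; rewrite mxE mul0r. Qed.

Lemma dotpp_gt0 u : (0 < dotp u u) = (u != 0).
Proof.
apply/idP/idP => [|u0].
  by apply: contraTneq => ->; rewrite dotp00 ltxx.
by rewrite (lt_le_trans _ (normr_sqr_le_dotp u))// exprn_gt0// normr_gt0.
Qed.

Lemma dotp_sub u v : dotp (u - v) (u - v) = dotp (v - u) (v - u).
Proof. by rewrite -opprB dotpNl dotpNr opprK. Qed.

Lemma convex_set_segment C u v l :
  convex_set C -> C u -> C v -> 0 <= l <= 1 -> C ((1 - l) *: u + l *: v).
Proof.
move=> cC Cu Cv /andP[l0 l1].
have := cC v u (Itv01 l0 l1).
by rewrite !inE addrC => /(_ Cv Cu).
Qed.

(** Moving from [p] towards [w] by a fraction [l] stays in [C], and minimality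
    of [p] makes the first-order term in [l] nonnegative. *)
Lemma metric_proj_variational C u p w : convex_set C ->
  is_metric_proj C u p -> C w -> dotp (u - p) (w - p) <= 0.
Proof.
move=> cC [Cp pmin] Cw.
set b := dotp (u - p) (w - p); set d := dotp (w - p) (w - p).
have d0 : 0 <= d := dotpp_ge0 _.
have bound l : 0 < l -> l <= 1 -> 2 * b <= l * d.
  move=> l0 l1.
  have := pmin _ (convex_set_segment cC Cp Cw (introT andP (conj (ltW l0) l1))).
  rewrite -(ler_pXn2r (_ : 0 < 2)%N) ?nnegrE ?sqrtr_ge0// !enorm_sqr.
  have -> : u - ((1 - l) *: p + l *: w) = (u - p) - l *: (w - p).
    by rewrite scalerBl scale1r scalerBr !opprD !opprK !addrA (addrAC (u - p)).
  move=> H; rewrite -subr_ge0.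
  rewrite -(pmulr_rge0 _ l0) /d /b; move: H; clear.
  move: (u - p) (w - p) => s t.
  rewrite !(dotpDl, dotpDr, dotpNl, dotpNr, dotpZl, dotpZr) (dotpC t s); nra.
rewrite leNgt; apply/negP => b0.
(* this fraction makes [l * d] smaller than [b] *)
have db : 0 < d + 2 * b by lra.
have := bound (b / (d + 2 * b)).
rewrite divr_gt0// ler_pdivrMr// mulrAC ler_pdivlMr// => /(_ isT).
nra.
Qed.

(** In the triangle [u], [p], [w] the angle at [p] is not acute, so the side
    opposite to it is the longest. *)
Lemma metric_proj_closer C u p w : convex_set C ->
  is_metric_proj C u p -> C w -> dotp (p - w) (p - w) <= dotp (u - w) (u - w).
Proof.
move=> cC pP Cw; have := metric_proj_variational cC pP Cw.
have := dotpp_ge0 (u - p).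
have -> : u - w = (u - p) - (w - p) by rewrite opprB addrA subrK.
have -> : p - w = - (w - p) by rewrite opprB.
move: (u - p) (w - p) => a b.
rewrite !(dotpDl, dotpDr, dotpNl, dotpNr) (dotpC b a); lra.
Qed.

Lemma cvg_dotp (F : set_system nat) {FF : Filter F}
    (a b : nat -> 'rV[R]_n) u v :
  a @ F --> u -> b @ F --> v -> dotp (a k) (b k) @[k --> F] --> dotp u v.
Proof.
move=> au bv; rewrite /dotp.
apply: (@cvg_big _ _ +%R 0); first exact: add_continuous.
move=> i _; apply: cvgM.
- apply: (@cvg_comp _ _ _ a (fun w : 'rV[R]_n => w 0 i) _ _ _ au).
  exact: coord_continuous.
- apply: (@cvg_comp _ _ _ b (fun w : 'rV[R]_n => w 0 i) _ _ _ bv).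
  exact: coord_continuous.
Qed.

Lemma cvg_enorm_sqr (F : set_system nat) {FF : Filter F}
    (a b : nat -> 'rV[R]_n) u v :
  a @ F --> u -> b @ F --> v ->
  enorm (a k - b k) ^+ 2 @[k --> F] --> enorm (u - v) ^+ 2.
Proof.
move=> au bv; rewrite enorm_sqr.
under eq_cvg do rewrite enorm_sqr.
by apply: cvg_dotp; apply: cvgB.
Qed.

Lemma cvg_of_dotp (F : set_system nat) {FF : Filter F} (a : nat -> 'rV[R]_n) u :
  dotp (a k - u) (a k - u) @[k --> F] --> 0 -> a @ F --> u.
Proof.
move=> a0; apply/cvgrPdistC_lt => e e0.
have e20 : 0 < e ^+ 2 by rewrite exprn_gt0.
near=> k.
rewrite -(ltr_pXn2r (_ : 0 < 2)%N) ?nnegrE// ?ltW//.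
apply: le_lt_trans (normr_sqr_le_dotp _) _.
by near: k; exact: (cvgr_lt 0 a0).
Unshelve. all: by end_near. Qed.

End Euclidean.

(** * Quasi-Fejer sequences *)

Section QuasiFejer.
Context {R : realType}.
Variables a d sigma : nat -> R.
Hypothesis a_ge0 : forall k, 0 <= a k.
Hypothesis d_gt0 : forall k, 0 < d k.
Hypothesis sigma_gt0 : forall k, 0 < sigma k.
Hypothesis sigma2_summable : cvgn (series (fun k => sigma k ^+ 2)).
Hypothesis a_step : forall k,
  a k.+1 <= a k - 2 * sigma k * d k + sigma k ^+ 2.

Let s2 := series (fun k => sigma k ^+ 2).
Let b k := a k - s2 k.

Let b_step k : b k.+1 <= b k - 2 * sigma k * d k.
Proof. by rewrite /b /s2 seriesSr; have := a_step k; lra. Qed.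

Let b_lbound : exists B, forall k, B <= b k.
Proof.
exists (- limn s2) => k; rewrite /b.
have : s2 k <= limn s2.
  apply: nondecreasing_cvgn_le => //; apply: nondecreasing_series => i _ _.
  exact: sqr_ge0.
have := a_ge0 k; lra.
Qed.

(** Subtracting the accumulated errors [sigma i ^+ 2] makes [a] nonincreasing
    and bounded below, and these errors have a finite sum. *)
Lemma quasi_fejer_cvg : cvgn a.
Proof.
have -> : a = b \+ s2 by apply/funext => k; rewrite /b/= subrK.
apply: is_cvgD => //; apply: nonincreasing_is_cvgn.
  apply/nonincreasing_seqP => k; apply: le_trans (b_step k) _.
  by rewrite gerBl ltW// !mulr_gt0.
by have [B HB] := b_lbound; exists B => _ [k _ <-].
Qed.

(** If the gains stayed above [e], then [a] would decrease, up to summable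
    errors, by at least [2 * e] times the divergent partial sums of [sigma]. *)
Lemma quasi_fejer_small_gain (e : R) (N : nat) :
  series sigma @ \oo --> +oo -> 0 < e -> exists2 k, (N <= k)%N & d k < e.
Proof.
move=> sigma_dvg e0; apply: contrapT => none.
have de k : (N <= k)%N -> e <= d k.
  by move=> Nk; rewrite leNgt; apply/negP => dk; apply: none; exists k.
have [B HB] := b_lbound.
pose c k := b k + 2 * e * series sigma k.
have cN m : c (N + m)%N <= c N.
  elim: m => [|m IH]; first by rewrite addn0.
  apply: le_trans IH; rewrite addnS /c seriesSr.
  have := b_step (N + m)%N.
  have := de _ (leq_addr m N); have := sigma_gt0 (N + m)%N; nra.
have /cvgryPgt/(_ ((c N - B) / (2 * e)))[M _ HM] := sigma_dvg.
have := HM (N + M)%N (leq_addl _ _).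
rewrite /= ltr_pdivrMr ?mulr_gt0// => gt.
have := cN M; have := HB (N + M)%N; rewrite {1}/c; lra.
Qed.

End QuasiFejer.

(** * Limits along ultrafilters *)

Lemma ultra_cvg_compact (I : Type) (T : topologicalType) (F : set_system I)
    (A : set T) (u : I -> T) :
  UltraFilter F -> compact A -> (forall i, A (u i)) ->
  exists2 l, A l & u @ F --> l.
Proof.
move=> FU cA Au; have FA : (u @ F) A by apply: (nearW (F := F)) => i; exact: Au.
have [l [Al clu]] := cA (u @ F) _ FA.
exists l => // B Bl.
have [//|nB] := in_ultra_setVsetC (u @^-1` B) FU.
by have [q [nBq /nBq]] := clu (~` B) B nB Bl.
Qed.

Lemma ultra_cvg_bounded (R : realType) (n : nat) (F : set_system nat)
    (u : nat -> 'rV[R]_n) (M : R) :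
  UltraFilter F -> (forall k, `|u k| <= M) -> exists l : 'rV[R]_n, u @ F --> l.
Proof.
move=> FU uM; pose A := [set w : 'rV[R]_n | `|w| <= M].
have [||l _ ul] := @ultra_cvg_compact _ _ F A u FU _ _; last by exists l.
  apply: bounded_closed_compact.
    by exists M; split=> [|M' /ltW MM' w /le_trans]; [exact: num_real|exact].
  apply: (@preimage_closed _ _ (fun w : 'rV[R]_n => `|w|) [set r | r <= M]).
    by move=> w _; exact: norm_continuous.
  exact: (@closed_le _ M).
exact: uM.
Qed.

(** The sets of all large indices with a small value of [d] are nonempty and
    generate a filter; any ultrafilter above it plays the role of a subsequence
    that never has to be refined again. *)
Lemma ultra_small_gain (R : realType) (d : nat -> R) :
  (forall k, 0 < d k) ->
  (forall e N, 0 < e -> exists2 k, (N <= k)%N & d k < e) ->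
  exists F : set_system nat,
    [/\ UltraFilter F, \oo `<=` F & d @ F --> 0].
Proof.
move=> d0 dsmall.
pose G := filter_from [set p : R * nat | 0 < p.1]
  (fun p => [set k | (p.2 <= k)%N /\ d k < p.1]).
have GF : ProperFilter G.
  apply: filter_from_proper; last first.
    by move=> [e N] /= e0; have [k Nk dk] := dsmall e N e0; exists k.
  apply: filter_from_filter; first by exists (1, 0%N) => /=.
  move=> [e N] [e' N'] /= e0 e0'; exists (Num.min e e', maxn N N') => /=.
    by rewrite lt_min e0.
  by move=> k [/=]; rewrite geq_max lt_min => /andP[? ?] /andP[? ?].
have [F [FU GsF]] := ultraFilterLemma GF; exists F; split => //.
  move=> A [N _ NA]; apply: GsF; exists (1, N) => //= k [Nk _]; exact: NA.
apply/cvgrPdist_lt => e e0; apply: GsF; exists (e, 0%N) => //= k [_ dk].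
by rewrite /= sub0r normrN gtr0_norm.
Qed.

(** A limit along a filter finer than the Frechet filter is a cluster point;
    the scalar sequence of distances to it reduces the extraction of a
    subsequence to the real case. *)
Lemma cvg_subsequence_of_filter (R : realType) (n : nat) (F : set_system nat)
    (u : nat -> 'rV[R]_n) (l : 'rV[R]_n) :
  ProperFilter F -> \oo `<=` F -> u @ F --> l ->
  exists2 phi : nat -> nat, increasing_seq phi & u \o phi @ \oo --> l.
Proof.
move=> FF ooF ul.
have [|phi phi_incr phi0] :=
    (cluster_eventually_cvg (fun k => `|u k - l|) 0).1 _.
  apply/cluster_eventuallyP => e N e0.
  have FN : F [set k | (N <= k)%N] by apply: ooF; exists N.
  have Fe : \forall k \near F, `|u k - l| < e.
    by move: (ul) => /cvgrPdistC_lt; exact.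
  have [k [Nk ke]] := filter_ex (filterI FN Fe).
  by exists k => //; rewrite sub0r normrN normr_id ltW.
exists phi => //; apply/subr_cvg0/norm_cvg0P; exact: phi0.
Qed.

(** * Generalized convexity and limits of subgradients *)

Lemma semistrict_lt_left (R : realType) (n : nat) (C : set 'rV[R]_n)
    (phi : 'rV[R]_n -> R) (u v : 'rV[R]_n) (t : R) :
  semistrictly_quasiconvex_on C phi -> C u -> C v -> 0 < t < 1 ->
  phi v < phi u -> phi ((1 - t) *: u + t *: v) < phi u.
Proof.
move=> [_ ss] Cu Cv /andP[t0 t1] vu.
have t01 : 0 < 1 - t < 1 by apply/andP; split; lra.
by have := ss v u (1 - t) Cv Cu t01 vu; rewrite subKr addrC.
Qed.

Section Bifunction.
Context {R : realType} {n : nat}.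
Variables (C : set 'rV[R]_n) (f : 'rV[R]_n -> 'rV[R]_n -> R).

Lemma continuous_at_square (u v : 'rV[R]_n) :
  (exists U : set ('rV[R]_n * 'rV[R]_n),
    [/\ open U, C `*` C `<=` U &
        {within U, continuous (fun p => f p.1 p.2)}]) ->
  C u -> C v -> f p.1 p.2 @[p --> (u, v)] --> f u v.
Proof.
move=> [U [oU CU]]; rewrite continuous_open_subspace// => cf Cu Cv.
by apply: (cf (u, v)); rewrite inE; apply: CU.
Qed.

Hypothesis f_cts : forall u v, C u -> C v ->
  f p.1 p.2 @[p --> (u, v)] --> f u v.

Lemma cvg_bifunction (F : set_system nat) {FF : Filter F}
    (a b : nat -> 'rV[R]_n) (u v : 'rV[R]_n) :
  C u -> C v -> a @ F --> u -> b @ F --> v ->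
  f (a k) (b k) @[k --> F] --> f u v.
Proof.
by move=> Cu Cv au bv; apply: (continuous2_cvg _ (f_cts Cu Cv) au bv).
Qed.

(** If [f zb p < f zb xb], then for small [e > 0] the point [p + e *: gb] stays
    strictly below [x k] in the order given by [f (z k)] for most [k], so
    [<g k, p + e *: gb - x k> < 0]; but the limit of these products is
    [e * <gb, gb> > 0]. The point [p + e *: gb] may leave [C], which is why
    continuity is needed in a full neighbourhood of [(zb, p)]. *)
Lemma star_subdiff2_limit_le (F : set_system nat) {FF : ProperFilter F}
    (x z g : nat -> 'rV[R]_n) (xb zb gb p : 'rV[R]_n) :
  C xb -> C zb -> C p -> x @ F --> xb -> z @ F --> zb -> g @ F --> gb ->
  (forall k, star_subdiff2 f (z k) (x k) (g k)) ->
  dotp gb (xb - p) = 0 -> 0 < dotp gb gb -> f zb xb <= f zb p.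
Proof.
move=> Cx Cz Cp xF zF gF sub gb0 gbgb; rewrite leNgt; apply/negP => lt.
pose c := (f zb p + f zb xb) / 2.
have pc : f zb p < c by rewrite /c; lra.
have cx : c < f zb xb by rewrite /c; lra.
have [[A B] /= [Azb Bp] AB] : \forall q \near (zb, p), f q.1 q.2 < c.
  exact: (cvgr_lt _ (f_cts Cz Cp)).
have push : p + e *: gb @[e --> (0 : R)^'+] --> p.
  rewrite -[X in _ --> X]addr0 -(scale0r gb).
  apply: cvgD; first exact: cvg_cst.
  by apply: cvgZ; [apply: cvg_at_right_filter; exact: cvg_id|exact: cvg_cst].
near (0 : R)^'+ => e.
have e0 : 0 < e by near: e; exact: nbhs_right_gt.
have Be : B (p + e *: gb) by near: e; exact: push.
have neg : \forall k \near F, dotp (g k) (p + e *: gb - x k) < 0.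
  have zA : \forall k \near F, A (z k) by exact: zF.
  have fx : \forall k \near F, c < f (z k) (x k).
    exact: (cvgr_gt _ (cvg_bifunction Cz Cx zF xF)).
  near=> k; apply: sub.
  have Ak : A (z k) by near: k.
  apply: (@lt_trans _ _ c); last by near: k.
  exact: (AB (z k, p + e *: gb)).
have lim : dotp (g k) (p + e *: gb - x k) @[k --> F]
    --> dotp gb (p + e *: gb - xb).
  by apply: cvg_dotp => //; apply: cvgB => //; exact: cvg_cst.
have : dotp gb (p + e *: gb - xb) <= 0.
  apply: (ler_cvg_to lim (cvg_cst 0)).
  by apply: filterS neg => k; exact: ltW.
have -> : p + e *: gb - xb = e *: gb - (xb - p) by rewrite opprB addrCA addrA.
rewrite dotpDr dotpZr dotpNr gb0 oppr0 addr0.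
by apply/negP; rewrite -ltNge mulr_gt0.
Unshelve. all: by end_near. Qed.

(** If [f u w <= 0], strong quasiconvexity makes [f u] negative to first order
    in the distance to [u] on the segment towards [w], while the regularization
    that has to compensate for it is only of second order. *)
Lemma quasi_solution_strict (u w : 'rV[R]_n) (rho : R) : convex_set C ->
  f u u = 0 -> strongly_quasiconvex_on C (f u) -> 0 < rho ->
  quasi_solutions C f rho u -> C w -> w != u -> 0 < f u w.
Proof.
move=> cC fu0 [gamma gamma0 sq] rho0 [Cu qs] Cw wu.
rewrite ltNge; apply/negP => fuw.
have d0 : 0 < dotp (w - u) (w - u) by rewrite dotpp_gt0 subr_eq0.
have small l : 0 < l -> l < 1 -> (1 - l) * gamma * rho <= l.
  move=> l0 l1.
  have l01 : 0 <= l <= 1 by rewrite !ltW.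
  have := sq w u l Cw Cu l01; rewrite fu0 enorm_sqr.
  have -> : Num.max (f u w) 0 = 0 by apply/max_idPr.
  have := qs _ (convex_set_segment cC Cu Cw l01).
  rewrite addrC [X in f u X]addrC enorm_sqr.
  have -> : (1 - l) *: u + l *: w - u = l *: (w - u).
    by apply/rowP => i; rewrite !mxE; ring.
  rewrite dotpZl dotpZr => q1 q2.
  have : 0 <= l * dotp (w - u) (w - u) *
      ((2 * rho)^-1 * l - (1 - l) * (gamma / 2)).
    lra.
  rewrite pmulr_rge0 ?mulr_gt0// subr_ge0 [leRHS]mulrC ler_pdivlMr; last lra.
  lra.
have G0 : 0 < gamma * rho by rewrite mulr_gt0.
(* a fraction small enough to violate [small] *)
pose l := gamma * rho / (2 * (1 + gamma * rho)).
have lE : l * (2 * (1 + gamma * rho)) = gamma * rho.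
  by rewrite /l divfK// gt_eqF//; lra.
have l0 : 0 < l by rewrite divr_gt0//; lra.
have l1 : l < 1 by rewrite ltr_pdivrMr; lra.
have := small l l0 l1; rewrite -mulrA.
move: lE G0 l0; move: (gamma * rho) => G lE G0 l0 le.
nra.
Qed.

End Bifunction.

(** * The sequences generated by the algorithm *)

Section InfiniteRun.
Context {R : realType} {n : nat}.
Variables (C : set 'rV[R]_n) (f : 'rV[R]_n -> 'rV[R]_n -> R).
Variables (alpha theta : R) (rho sigma : nat -> R) (rhobar : R).
Variables x y z g : nat -> 'rV[R]_n.
Hypothesis C_closed : closed C.
Hypothesis C_convex : convex_set C.
Hypothesis f_diag : forall u, C u -> f u u = 0.
Hypothesis f_cts : forall u v, C u -> C v ->
  f p.1 p.2 @[p --> (u, v)] --> f u v.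
Hypothesis f_semistrict : forall u, C u -> semistrictly_quasiconvex_on C (f u).
Hypothesis params : algorithm_parameters alpha theta rho sigma rhobar.
Hypothesis run : infinite_run C f alpha theta rho sigma x y z g.

Lemma theta_pow_itv (m : nat) : (0 < m)%N -> 0 < theta ^+ m <= theta.
Proof.
have /andP[t0 t1] := theta_in01 params; case: m => // m _.
by rewrite exprn_gt0//= exprS ler_piMr ?exprn_ile1// ltW.
Qed.

Lemma x_in_C k : C (x k).
Proof.
case: k => [|k]; first exact: start_in run.
by have [] := projection_step run k.
Qed.

Lemma y_in_C k : C (y k).
Proof. by have [] := prox_step run k. Qed.

Lemma trial_point_in_C u v (m : nat) : (0 < m)%N -> C u -> C v ->
  C (trial_point theta u v m).
Proof.
move=> m0 Cu Cv; apply: convex_set_segment => //.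
have /andP[t0 tt] := theta_pow_itv m0; have /andP[_ t1] := theta_in01 params.
by rewrite !ltW// (le_lt_trans tt).
Qed.

Lemma z_in_C k : C (z k).
Proof.
have [m [m0 _ _] ->] := linesearch_step run k.
by apply: trial_point_in_C => //; [exact: x_in_C|exact: y_in_C].
Qed.

Lemma alpha_rho_gt0 k : 0 < alpha / (2 * rho k).
Proof.
have /andP[a0 _] := alpha_in01 params; have r0 := rho_pos params k.
by rewrite divr_gt0// mulr_gt0.
Qed.

(** The linesearch test makes [f (z k)] smaller at [y k] than at [x k], and by
    semi-strictness it is also smaller at [z k], where it is [0], than at
    [x k]. *)
Lemma f_zx_gt0 k : 0 < f (z k) (x k).
Proof.
have [m [m0 test _] zE] := linesearch_step run k.
have /andP[t0 tt] := theta_pow_itv m0; have /andP[_ t1] := theta_in01 params.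
have drop : f (z k) (y k) < f (z k) (x k).
  rewrite -subr_gt0; move: test; rewrite /linesearch_test -zE.
  apply: lt_le_trans; rewrite mulr_gt0 ?alpha_rho_gt0// enorm_sqr dotpp_gt0.
  by rewrite subr_eq0; apply/eqP; exact: no_stop_y run k.
rewrite -[ltLHS](f_diag (z_in_C k)) {2}zE.
apply: (semistrict_lt_left (f_semistrict (z_in_C k)) (x_in_C k)) => //.
  exact: y_in_C.
by rewrite t0 (le_lt_trans tt).
Qed.

Lemma subgradient_separates k p : dual_solutions C f p ->
  0 < dotp (g k) (x k - p).
Proof.
move=> [Cp fp]; have := subgradient_step run (_ : f (z k) p < f (z k) (x k)).
rewrite -opprB dotpNr oppr_lt0; apply.
by apply: le_lt_trans (f_zx_gt0 k); exact: fp (z_in_C k).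
Qed.

(** The last term is [|sigma k *: g k|^2], because [g k] has norm [1]; the
    projection onto [C] does not increase the distance to [p]. *)
Lemma quasi_fejer_step k p : C p ->
  dotp (x k.+1 - p) (x k.+1 - p) <=
  dotp (x k - p) (x k - p) - 2 * sigma k * dotp (g k) (x k - p) + sigma k ^+ 2.
Proof.
move=> Cp.
apply: le_trans (metric_proj_closer C_convex (projection_step run k) Cp) _.
have g1 : dotp (g k) (g k) = 1.
  by rewrite -enorm_sqr (subgradient_normalized run) expr1n.
rewrite (addrAC (x k)); move: (x k - p) => d.
rewrite !(dotpDl, dotpDr, dotpNl, dotpNr, dotpZl, dotpZr) g1 (dotpC d (g k)).
by lra.
Qed.

Lemma dist_to_dual_solution_cvg p : dual_solutions C f p ->
  cvgn (fun k => dotp (x k - p) (x k - p)).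
Proof.
move=> Sp; have [Cp _] := Sp.
apply: (@quasi_fejer_cvg _ _ (fun k => dotp (g k) (x k - p)) sigma).
- by move=> k; exact: dotpp_ge0.
- by move=> k; exact: subgradient_separates.
- exact: sigma_pos params.
- exact: sigma2_summable params.
- by move=> k; exact: quasi_fejer_step.
Qed.

Lemma x_bounded p : dual_solutions C f p ->
  exists M, forall k, `|x k| <= M.
Proof.
move=> Sp.
have [M M0 HM] :=
  pinfty_ex_gt0 (cvg_seq_bounded (dist_to_dual_solution_cvg Sp)).
exists (`|p| + (1 + M)) => k.
rewrite -[x k](subrK p) addrC (le_trans (ler_normD _ _))// lerD2l.
have := le_trans (le_trans (normr_sqr_le_dotp (x k - p)) (ler_norm _)) (HM k I).
have := normr_ge0 (x k - p); nra.
Qed.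

(** * Limit points of the run *)

Section Limits.
Variable F : set_system nat.
Context {FU : UltraFilter F}.
Hypothesis oo_F : \oo `<=` F.
Variables xb yb zb : 'rV[R]_n.
Hypothesis xF : x @ F --> xb.
Hypothesis yF : y @ F --> yb.
Hypothesis zF : z @ F --> zb.

Lemma limit_in_C (u : nat -> 'rV[R]_n) ub :
  (forall k, C (u k)) -> u @ F --> ub -> C ub.
Proof.
by move=> Cu uF; apply: (closed_cvg C C_closed _ ub uF); exact: nearW.
Qed.

Lemma cvg_weight (a : R) : a / (2 * rho k) @[k --> F] --> a / (2 * rhobar).
Proof.
have rho_F : rho @ F --> rhobar.
  by move=> B /(rho_cvg params)/oo_F.
apply: cvgM; first exact: cvg_cst.
apply: cvgV; last by apply: cvgM => //; exact: cvg_cst.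
by rewrite mulf_neq0// gt_eqF// (rhobar_pos params).
Qed.

(** The competitor is a sequence so that the limiting proximal value at [yb] can
    be compared both with a fixed point of [C] and with the moving [x k]. *)
Lemma prox_limit (w : nat -> 'rV[R]_n) wb :
  (forall k, C (w k)) -> w @ F --> wb ->
  f xb yb + 1 / (2 * rhobar) * enorm (xb - yb) ^+ 2 <=
  f xb wb + 1 / (2 * rhobar) * enorm (xb - wb) ^+ 2.
Proof.
move=> Cw wF.
have lim (v : nat -> 'rV[R]_n) vb : (forall k, C (v k)) -> v @ F --> vb ->
    f (x k) (v k) + 1 / (2 * rho k) * enorm (x k - v k) ^+ 2 @[k --> F] -->
    f xb vb + 1 / (2 * rhobar) * enorm (xb - vb) ^+ 2.
  move=> Cv vF; apply: cvgD.
    apply: (cvg_bifunction f_cts) => //; first exact: limit_in_C x_in_C xF.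
    exact: limit_in_C vF.
  by apply: cvgM; [exact: cvg_weight|exact: cvg_enorm_sqr].
apply: (ler_cvg_to (lim _ _ y_in_C yF) (lim _ _ Cw wF)).
apply: nearW => k; rewrite mul1r.
by have [_] := prox_step run k; exact.
Qed.

(** Suppose [yb != xb]. Then [f zb xb] is positive: if the accepted steps have a
    positive limit, the test passes to the limit and semi-strictness applies as
    it does for each [k]. If they tend to [0], the rejected trial points
    preceding them tend to [xb], so that [- f xb yb] is at most [alpha] times
    the regularization, while optimality makes it at least the whole of it. *)
Lemma limit_y_eq_x : f zb xb <= 0 -> yb = xb.
Proof.
move=> fzx.
have Cxb := limit_in_C x_in_C xF; have Cyb := limit_in_C y_in_C yF.
have Czb := limit_in_C z_in_C zF.
have /andP[a0 a1] := alpha_in01 params; have /andP[t0 t1] := theta_in01 params.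
have r0 := rhobar_pos params.
have c0 : 0 < 1 / (2 * rhobar) by rewrite divr_gt0// mulr_gt0.
apply/eqP; apply: contraPT fzx => yx; apply/negP; rewrite -ltNge.
have d0 : 0 < enorm (yb - xb) ^+ 2 by rewrite enorm_sqr dotpp_gt0 subr_eq0.
have lim_test (v : nat -> 'rV[R]_n) vb : (forall k, C (v k)) -> v @ F --> vb ->
    f (v k) (x k) - f (v k) (y k) @[k --> F] --> f vb xb - f vb yb.
  move=> Cv vF; have Cvb := limit_in_C Cv vF.
  by apply: cvgB; exact: (cvg_bifunction f_cts).
have lim_step : alpha / (2 * rho k) * enorm (y k - x k) ^+ 2 @[k --> F] -->
    alpha / (2 * rhobar) * enorm (yb - xb) ^+ 2.
  by apply: cvgM; [exact: cvg_weight|exact: cvg_enorm_sqr].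
have /choice[m mP] : forall k, exists m : nat,
    is_least_positive (linesearch_test f alpha theta (rho k) (x k) (y k)) m /\
    z k = trial_point theta (x k) (y k) m.
  by move=> k; have [m] := linesearch_step run k; exists m.
pose t k := theta ^+ m k.
have t_itv k : `[0, theta]%classic (t k).
  have [[m0 _ _] _] := mP k; have /andP[tk0 tkt] := theta_pow_itv m0.
  by rewrite /= in_itv/= ltW.
have [tb] := ultra_cvg_compact FU (@segment_compact R 0 theta) t_itv.
rewrite /= in_itv/= => /andP[tb0 tbt] tF.
have trial (s : nat -> R) sb : s @ F --> sb ->
    (1 - s k) *: x k + s k *: y k @[k --> F] --> (1 - sb) *: xb + sb *: yb.
  move=> sF; apply: cvgD; apply: cvgZ => //.
  by apply: cvgB => //; exact: cvg_cst.
have zbE : zb = (1 - tb) *: xb + tb *: yb.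
  apply: (cvg_unique _ zF) => //.
  have -> : z = fun k => (1 - t k) *: x k + t k *: y k.
    by apply/funext => k; have [_ ->] := mP k.
  exact: trial.
have [tbE|tb_gt0] := eqVneq tb 0.
  (* the default [x k] is harmless: steps below [theta] have exponent above 1,
     so that it is used only outside a set of the filter *)
  pose v k :=
    if (1 < m k)%N then trial_point theta (x k) (y k) (m k).-1 else x k.
  have m_gt1 : \forall k \near F, (1 < m k)%N.
    have tlt : \forall k \near F, t k < theta.
      by apply: (cvgr_lt tb) => //; rewrite tbE.
    apply: filterS tlt => k; have [[m0 _ _] _] := mP k; rewrite /t.
    by case: (m k) m0 => [//|[|//]] _; rewrite expr1 ltxx.
  have Cv k : C (v k).
    rewrite /v; case: ifP => [m1|_]; last exact: x_in_C.
    apply: trial_point_in_C; [|exact: x_in_C|exact: y_in_C].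
    by rewrite -ltnS prednK// ltnW.
  have vF : v @ F --> xb.
    pose s k := t k / theta.
    have sF : s @ F --> (0 : R).
      by rewrite -(mul0r theta^-1) -tbE; apply: cvgM => //; exact: cvg_cst.
    have := trial s 0 sF; rewrite subr0 scale1r scale0r addr0.
    apply: cvg_trans; apply: near_eq_cvg.
    apply: filterS m_gt1 => k m1; rewrite /v m1 /trial_point.
    suff -> : theta ^+ (m k).-1 = s k by [].
    by rewrite /s /t; case: (m k) m1 => // j _; rewrite exprSr mulfK// gt_eqF.
  have fail : f xb xb - f xb yb <= alpha / (2 * rhobar) * enorm (yb - xb) ^+ 2.
    apply: (ler_cvg_to (lim_test v xb Cv vF) lim_step).
    apply: filterS m_gt1 => k m1; rewrite leNgt; apply/negP => /ltW pass.
    have [[_ _ least] _] := mP k.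
    have m1' : (0 < (m k).-1)%N by rewrite -ltnS prednK// ltnW.
    have := least (m k).-1 m1'; rewrite /linesearch_test.
    rewrite /v m1 in pass; move=> /(_ pass).
    by rewrite leqNgt prednK ?leqnn// ltnW.
  have := prox_limit x_in_C xF; move: fail.
  rewrite f_diag// subrr !enorm_sqr (dotp_sub xb yb) dotp00.
  rewrite (_ : alpha / _ = alpha * (1 / (2 * rhobar))); last first.
    by rewrite mulrA mulr1.
  rewrite enorm_sqr in d0.
  have : 0 < (1 - alpha) * (1 / (2 * rhobar) * dotp (yb - xb) (yb - xb)).
    by apply: mulr_gt0; [rewrite subr_gt0|exact: mulr_gt0].
  move: (1 / _) => c; lra.
have pass : alpha / (2 * rhobar) * enorm (yb - xb) ^+ 2 <= f zb xb - f zb yb.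
  apply: (ler_cvg_to lim_step (lim_test z zb z_in_C zF)); apply: nearW => k.
  by have [[_ + _] zE] := mP k; rewrite /linesearch_test -zE.
rewrite -[ltLHS](f_diag Czb) [X in f _ X < _]zbE.
apply: (semistrict_lt_left (f_semistrict Czb)) => //.
  by rewrite lt_def tb_gt0 tb0 (le_lt_trans tbt).
rewrite -subr_gt0; apply: lt_le_trans pass.
by rewrite mulr_gt0// divr_gt0// mulr_gt0.
Qed.

Lemma limit_quasi_solution : f zb xb <= 0 -> quasi_solutions C f rhobar xb.
Proof.
move=> fzx; have yx := limit_y_eq_x fzx.
split=> [|w Cw]; first exact: limit_in_C x_in_C xF.
have := prox_limit (fun=> Cw) (cvg_cst w).
rewrite yx f_diag; last exact: limit_in_C x_in_C xF.
by rewrite subrr !enorm_sqr dotp00 mulr0 addr0 (dotp_sub w xb) div1r; exact.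
Qed.

End Limits.

(** The selected ultrafilter makes the gains vanish in the limit, which is the
    orthogonality [<gb, xb - p> = 0] on which [f zb xb <= 0] rests. *)
Lemma cluster_quasi_solution p : dual_solutions C f p -> bounded_fun y ->
  exists (phi : nat -> nat) (xb : 'rV[R]_n),
    [/\ increasing_seq phi, x \o phi @ \oo --> xb &
        quasi_solutions C f rhobar xb].
Proof.
move=> Sp y_bnd; have [Cp fp] := Sp.
have gain_gt0 k := subgradient_separates k Sp.
have gain_small (e : R) (N : nat) : 0 < e ->
    exists2 k, (N <= k)%N & dotp (g k) (x k - p) < e.
  apply: (@quasi_fejer_small_gain _ (fun k => dotp (x k - p) (x k - p))
    _ sigma).
  - by move=> k; exact: dotpp_ge0.
  - exact: sigma_pos params.
  - exact: sigma2_summable params.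
  - by move=> k; exact: quasi_fejer_step.
  - exact: sigma_diverges params.
have [F [FU ooF gain]] := ultra_small_gain gain_gt0 gain_small.
have [Mx xM] := x_bounded Sp; have [xb xF] := ultra_cvg_bounded FU xM.
have [My _ yM] := pinfty_ex_gt0 y_bnd.
have [yb yF] := ultra_cvg_bounded FU (fun k => yM k I).
have gM k : `|g k| <= 1.
  rewrite -(expr_le1 (_ : 0 < 2)%N)//; apply: le_trans (normr_sqr_le_dotp _) _.
  by rewrite -enorm_sqr (subgradient_normalized run) expr1n.
have [gb gF] := ultra_cvg_bounded FU gM.
have zM k : `|z k| <= Mx + My.
  have [m [m0 _ _] ->] := linesearch_step run k.
  have /andP[t0 tt] := theta_pow_itv m0; have /andP[_ t1] := theta_in01 params.
  have tm1 : theta ^+ m <= 1 by rewrite (le_trans tt)// ltW.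
  apply: le_trans (ler_normD _ _) _; rewrite !normrZ.
  rewrite ger0_norm ?subr_ge0// (gtr0_norm t0).
  have := xM k; have := yM k I.
  have := normr_ge0 (x k); have := normr_ge0 (y k).
  move: t0 tm1 => /=; nra.
have [zb zF] := ultra_cvg_bounded FU zM.
have Czb : C zb by exact: limit_in_C z_in_C zF.
have Cxb : C xb by exact: limit_in_C x_in_C xF.
have gb1 : dotp gb gb = 1.
  have gg : dotp (g k) (g k) @[k --> F] --> dotp gb gb by exact: cvg_dotp.
  apply: (cvg_unique _ gg) => //.
  have -> : (fun k => dotp (g k) (g k)) = cst 1.
    apply/funext => k.
    by rewrite -enorm_sqr (subgradient_normalized run) expr1n.
  exact: cvg_cst.
have gb0 : dotp gb (xb - p) = 0.
  apply: (cvg_unique _ _ gain) => //.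
  by apply: cvg_dotp => //; apply: cvgB => //; exact: cvg_cst.
have fzx : f zb xb <= 0.
  apply: le_trans _ (fp _ Czb).
  apply: (star_subdiff2_limit_le f_cts Cxb Czb Cp xF zF gF _ gb0).
    exact: subgradient_step run.
  by rewrite gb1.
have [phi phi_incr phiF] :=
  cvg_subsequence_of_filter (@ultra_proper _ F FU) ooF xF.
by exists phi, xb; split => //; exact: (limit_quasi_solution ooF xF yF zF).
Qed.

End InfiniteRun.

(** * Convergence *)

(** An equilibrium is a quasi-solution for every positive parameter, since the
    regularization only adds a nonnegative term. *)
Lemma strong_equilibrium_strict (R : realType) (n : nat) (C : set 'rV[R]_n)
    (f : 'rV[R]_n -> 'rV[R]_n -> R) (rho : R) (u w : 'rV[R]_n) :
  convex_set C -> f u u = 0 -> strongly_quasiconvex_on C (f u) -> 0 < rho ->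
  equilibria C f u -> C w -> w != u -> 0 < f u w.
Proof.
move=> cC fu0 sq rho0 [Cu eu] Cw wu.
apply: (quasi_solution_strict cC fu0 sq rho0 _ Cw wu); split=> // v Cv.
by rewrite addr_ge0 ?eu// mulr_ge0 ?sqr_ge0// invr_ge0 mulr_ge0// ltW.
Qed.

Theorem theorem1 (R : realType) (n : nat) (C : set 'rV[R]_n)
    (f : 'rV[R]_n -> 'rV[R]_n -> R)
    (alpha theta : R) (rho sigma : nat -> R) (rhobar : R)
    (x y z g : nat -> 'rV[R]_n)
    (C_nonempty : C !=set0) (C_closed : closed C) (C_convex : convex_set C)
    (f_diag : forall u, C u -> f u u = 0)
    (f_continuous : exists U : set ('rV[R]_n * 'rV[R]_n),
      [/\ open U, C `*` C `<=` U &
          {within U, continuous (fun p => f p.1 p.2)}])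
    (f_semistrict : forall u, C u -> semistrictly_quasiconvex_on C (f u))
    (Sd_nonempty : dual_solutions C f !=set0)
    (params : algorithm_parameters alpha theta rho sigma rhobar)
    (run : infinite_run C f alpha theta rho sigma x y z g)
    (y_bounded : bounded_fun y) :
  (exists (phi : nat -> nat) (xbar : 'rV[R]_n),
      [/\ increasing_seq phi, x \o phi @ \oo --> xbar &
          quasi_solutions C f rhobar xbar])
  /\
  ((forall u, C u -> strongly_quasiconvex_on C (f u)) ->
   exists xs : 'rV[R]_n,
     [/\ equilibria C f xs,
         (forall xs' : 'rV[R]_n, equilibria C f xs' -> xs' = xs) &
         x @ \oo --> xs]).
Proof.
have [p Sp] := Sd_nonempty; have [Cp fp] := Sp.
have f_cts u v : C u -> C v -> f q.1 q.2 @[q --> (u, v)] --> f u v.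
  exact: continuous_at_square f_continuous.
have r0 := rhobar_pos params.
have [phi [xb [phi_incr phiF qs]]] := cluster_quasi_solution C_closed C_convex
  f_diag f_cts f_semistrict params run Sp y_bounded.
split; first by exists phi, xb.
move=> strong; have [Cxb _] := qs.
have eq_p u : C u -> (forall w, C w -> w != u -> 0 < f u w) -> u = p.
  move=> Cu pos; apply/eqP; rewrite eq_sym; apply: contraT => pu.
  by have := pos p Cp pu; rewrite ltNge fp.
have xb_pos w : C w -> w != xb -> 0 < f xb w.
  exact: quasi_solution_strict C_convex (f_diag _ Cxb) (strong _ Cxb) r0 qs.
have xbp := eq_p xb Cxb xb_pos; exists xb; split.
- split=> // w Cw; have [->|wxb] := eqVneq w xb; first by rewrite f_diag.
  exact/ltW/xb_pos.
- move=> u eu; have [Cu _] := eu; rewrite xbp; apply: eq_p => // w Cw.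
  exact: strong_equilibrium_strict C_convex (f_diag _ Cu) (strong _ Cu)
    r0 eu Cw.
(* the distances to [p] converge, so their limit can be read off [phi] *)
rewrite {}xbp in phiF *; apply: cvg_of_dotp.
have dcvg :=
  dist_to_dual_solution_cvg C_convex f_diag f_semistrict params run Sp.
suff <- : limn (fun k => dotp (x k - p) (x k - p)) = 0 by [].
have phi_oo : phi @ \oo --> \oo.
  apply/cvgnyPge => N; exists N => // k /= Nk; apply: leq_trans Nk _.
  elim: k => // k IH; apply: leq_ltn_trans IH _.
  by move/increasing_seqP : phi_incr; exact.
apply: (cvg_unique _ (cvg_comp _ _ phi_oo dcvg)) => //.
rewrite -(dotp00 (n := n)) -(subrr p) /=.
by apply: cvg_dotp; apply: cvgB => //; exact: cvg_cst.
Qed.
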